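(* Let $f\in\mathrm{LC}$ satisfy (H$_1$), (H$_3$) and (H$_2^*$) there are $\alpha_1>0$ and $K\ge1$ with $\exp\big(\int_s^t\alpha(u)du\big)\le Ke^{-\alpha_1(t-s)}$ for $0\le s\le t$. Then for every $\tau\in\mathbb R$ the solutions of $\dot x=f(t,x)$ are uniformly ultimately bounded on $[\tau,\infty)$.
   Context: $\mathrm{LC}$: Borel measurable $f:\mathbb R\times\mathbb R^N\to\mathbb R^N$ such that for every compact $K$ there are $m^K,l^K\in L^1_{loc}$ with $|f(t,x)|\le m^K(t)$ and $|f(t,x)-f(t,y)|\le l^K(t)|x-y|$ for $x,y\in K$, a.e. $t$. (H$_1$): there exist $\alpha,\beta\in L^1_{loc}$ with $\beta\ge0$ such that $2\langle f(t,x),x\rangle\le\alpha(t)|x|^2+\beta(t)$ for a.e. $(t,x)\in\mathbb R^{1+N}$. (H$_3$): $\sup_{t\in\mathbb R}\int_{-r}^r\beta(s+t)ds<\infty$ for every $r>0$. Under (H$_1$) solutions of $\dot x=f(t,x)$, $x(r)=x_0$ exist on $[r,\infty)$; $S_f(t,r)x_0$ denotes their value at $t\ge r$. The solutions are uniformly ultimately bounded on $[\tau,\infty)$ if there is $c(\tau)>0$ such that for every $d>0$ there is $T(\tau,d)>0$ with $|S_f(t+r,r)x_0|\le c(\tau)$ whenever $r\ge\tau$, $t\ge T(\tau,d)$, $|x_0|\le d$. *)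

(* Defs.v *)
From HB Require Import structures.
From mathcomp Require Import all_boot all_order all_algebra.
From mathcomp Require Import all_classical all_reals all_analysis.
Set Implicit Arguments. Unset Strict Implicit. Unset Printing Implicit Defensive.
Import Order.TTheory GRing.Theory Num.Theory.
Import numFieldNormedType.Exports.
Local Open Scope classical_set_scope.
Local Open Scope ring_scope.

(* R^N is represented by row vectors 'rV[R]_N (topology = product topology). *)
Section Defs.
Variables (R : realType) (N : nat).
Local Notation vec := 'rV[R]_N.

Definition dotv (x y : vec) : R := \sum_(i < N) x ord0 i * y ord0 i.
Definition enorm (x : vec) : R := Num.sqrt (dotv x x).

Definition borel_fun (g : R * vec -> R) : Prop :=
  forall B : set R, measurable B -> <<s open >> (g @^-1` B).

Definition borel_vfield (f : R -> vec -> vec) : Prop :=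
  forall i : 'I_N, borel_fun (fun p => f p.1 p.2 ord0 i).

Definition locint (g : R -> R) : Prop :=
  forall a b : R, lebesgue_measure.-integrable `[a, b] (EFin \o g).

(* Lebesgue-null sets of R^{1+N} = R x R^N: coverable by countably many
   closed boxes of arbitrarily small total volume. *)
Definition box (a b : R * vec) : set (R * vec) :=
  [set p : R * vec | (a.1 <= p.1 <= b.1) /\ forall i, a.2 ord0 i <= p.2 ord0 i <= b.2 ord0 i].
Definition boxvol (a b : R * vec) : R :=
  Num.max 0 (b.1 - a.1) * \prod_(i < N) Num.max 0 (b.2 ord0 i - a.2 ord0 i).
Definition null_set (E : set (R * vec)) : Prop :=
  forall eps : R, 0 < eps -> exists a b : nat -> R * vec,
    E `<=` \bigcup_k box (a k) (b k) /\
    forall n, \sum_(k < n) boxvol (a k) (b k) <= eps.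

Definition LC (f : R -> vec -> vec) : Prop :=
  borel_vfield f /\
  forall K : set vec, compact K -> exists m l : R -> R,
    locint m /\ locint l /\
    {ae lebesgue_measure, forall t, forall x y, K x -> K y ->
       enorm (f t x) <= m t /\ enorm (f t x - f t y) <= l t * enorm (x - y)}.

Definition H1 (f : R -> vec -> vec) (alpha beta : R -> R) : Prop :=
  locint alpha /\ locint beta /\ (forall t, 0 <= beta t) /\
  exists E, null_set E /\ forall t x, ~ E (t, x) ->
    2 * dotv (f t x) x <= alpha t * enorm x ^+ 2 + beta t.

Definition H3 (beta : R -> R) : Prop :=
  forall r : R, 0 < r -> exists C : R, forall t : R,
    Rintegral lebesgue_measure `[- r, r] (fun s => beta (s + t)) <= C.

Definition H2star (alpha : R -> R) : Prop :=
  exists alpha1 K : R, 0 < alpha1 /\ 1 <= K /\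
    forall s t : R, 0 <= s -> s <= t ->
      expR (Rintegral lebesgue_measure `[s, t] alpha)
        <= K * expR (- alpha1 * (t - s)).

Definition is_solution (f : R -> vec -> vec) (r : R) (x0 : vec)
    (x : R -> vec) : Prop :=
  x r = x0 /\
  forall t, r <= t -> forall i : 'I_N,
    lebesgue_measure.-integrable `[r, t] (fun s => (f s (x s) ord0 i)%:E) /\
    x t ord0 i = x0 ord0 i
                 + Rintegral lebesgue_measure `[r, t] (fun s => f s (x s) ord0 i).

Definition UUB (f : R -> vec -> vec) (tau : R) : Prop :=
  exists c : R, 0 < c /\
  forall d : R, 0 < d -> exists T : R, 0 < T /\
    forall (r t : R) (x0 : vec) (x : R -> vec),
      tau <= r -> T <= t -> enorm x0 <= d -> is_solution f r x0 x ->
      enorm (x (t + r)) <= c.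

End Defs.

(* Main.v *)
(* Along a solution x, u = |x|^2 satisfies u' <= alpha u + beta almost
   everywhere, so Gronwall's inequality together with (H2* ) shows that u is at
   least halved, up to a bounded error controlled by (H3), over every time window
   of a fixed length in [0, oo); iterating gives a bound independent of the
   initial size.

   (H1) is only assumed off a null set of R^{1+N}, which may contain the graph
   of x: by a Fubini argument almost every time slice of the null set has dense
   complement, and the Lipschitz continuity of f(t, .) extends the inequality to
   all x.

   Since u is only absolutely continuous, Gronwall's inequality is not obtained
   by differentiation: u(t) - u(s) is exactly the integral over [s, t] of
   <f(w, x(w)), x(t) + x(s)>, which makes the inequality hold up to an
   arbitrarily small multiple of an integral over [s, t], and such local
   inequalities add up. *)
Require Import Defs.
From HB Require Import structures.
From mathcomp Require Import all_boot all_order all_algebra.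
From mathcomp Require Import all_classical all_reals all_analysis.
From mathcomp Require Import measurable_realfun ring lra.
Import Order.TTheory GRing.Theory Num.Theory.
Import numFieldNormedType.Exports.
Set Implicit Arguments. Unset Strict Implicit. Unset Printing Implicit Defensive.
Local Open Scope classical_set_scope.
Local Open Scope ring_scope.

(** * Volume of a box covered by countably many boxes *)

Section BoxCover.
Context {R : realType}.
Local Notation mu := (@lebesgue_measure R).

Lemma lebesgue_measure_itv_cc (a b : R) :
  mu `[a, b]%classic = (Num.max 0 (b - a))%:E.
Proof.
rewrite lebesgue_measure_itv /= lte_fin.
have [ab|ba] := ltP a b; first by rewrite max_r ?EFinB// subr_ge0 ltW.
by rewrite max_l// subr_le0.
Qed.

Lemma measurable_nneseries_itv (c A B : nat -> R) (S : set R) :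
  (forall k, 0 <= c k) ->
  measurable_fun S
    (fun t => \sum_(k <oo) (c k * \1_(`[A k, B k]%classic) t)%:E)%E.
Proof.
move=> c0; apply: (@ge0_emeasurable_sum _ _ _ _ _ xpredT) => [k t _ _|k _].
  by rewrite lee_fin mulr_ge0// indicE.
by apply/measurable_EFinP/measurable_funM.
Qed.

(** Nonnegativity allows termwise integration, and restricting to [S] can only shorten each
    interval. *)
Lemma integral_nneseries_itv_le (c A B : nat -> R) (S : set R) :
  measurable S -> (forall k, 0 <= c k) ->
  (\int[mu]_(t in S) (\sum_(k <oo) (c k * \1_(`[A k, B k]%classic) t)%:E)
   <= \sum_(k <oo) (c k * Num.max 0 (B k - A k))%:E)%E.
Proof.
move=> mS c0.
have cI0 k t : 0 <= c k * \1_(`[A k, B k]%classic) t.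
  by rewrite mulr_ge0// indicE.
rewrite integral_nneseries//; last 2 first.
- move=> k; apply/measurable_EFinP/measurable_funM => //.
- by move=> k t _; rewrite lee_fin.
apply: lee_nneseries => [k _ _|k _].
  by apply: integral_ge0 => t _; rewrite lee_fin.
under eq_integral do rewrite EFinM.
rewrite ge0_integralZl ?lee_fin//; last exact/measurable_EFinP.
rewrite integral_indic//.
rewrite EFinM lee_wpmul2l ?lee_fin//.
rewrite -lebesgue_measure_itv_cc le_measure ?inE//; exact: measurableI.
Qed.

(** Points are sequences read below index [n], so that induction on the dimension involves no change
    of type. *)
Definition inbox n (a b p : nat -> R) := forall i, (i < n)%N -> a i <= p i <= b i.
Definition vol n (a b : nat -> R) := \prod_(i < n) Num.max 0 (b i - a i).

Lemma vol_ge0 n a b : 0 <= vol n a b.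
Proof. by apply: prodr_ge0 => i _; rewrite le_max lexx. Qed.

Lemma volS n a b : vol n.+1 a b = vol n a b * Num.max 0 (b n - a n).
Proof. by rewrite /vol big_ord_recr. Qed.

(* Slicing along the last coordinate reduces the dimension. *)
Lemma vol_le_cover n (a b : nat -> R) (A B : nat -> nat -> R) (D : set nat) :
  (forall p, inbox n a b p -> exists2 k, D k & inbox n (A k) (B k) p) ->
  ((vol n a b)%:E <= \sum_(k <oo) (\1_D k * vol n (A k) (B k))%:E)%E.
Proof.
elim: n D => [|n IH] D cov.
  (* In dimension 0 membership is vacuous, so [D] is nonempty and one of its terms is the empty
     product 1. *)
  have [k Dk _] := cov a (fun i (h : (i < 0)%N) => False_ind _ (notF h)).
  rewrite (@nneseriesD1 _ _ k)//; last first.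
    by move=> j _; rewrite lee_fin mulr_ge0 ?vol_ge0.
  rewrite indicE mem_set// mul1r /vol !big_ord0 leeDl//.
  apply: nneseries_ge0 => j _ _; rewrite lee_fin mulr_ge0 //.
  by rewrite big_ord0.
pose c k : R := \1_D k * vol n (A k) (B k).
have c0 k : 0 <= c k by rewrite mulr_ge0 ?vol_ge0.
rewrite volS EFinM -lebesgue_measure_itv_cc -integral_cst//.
apply: (@le_trans _ _ (\int[mu]_(t in `[a n, b n])
    (\sum_(k <oo) (c k * \1_(`[A k n, B k n]%classic) t)%:E))%E); last first.
  apply: le_trans (integral_nneseries_itv_le _ _ _ _) _ => //.
  apply: lee_nneseries => [k _ _|k _].
    by rewrite lee_fin mulr_ge0// le_max lexx.
  by rewrite /c volS mulrA.
apply: ge0_le_integral => //.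
- by move=> t _; rewrite lee_fin vol_ge0.
- exact: measurable_nneseries_itv.
move=> t; rewrite /= in_itv/= => tab.
(* Only the boxes whose last side contains [t] meet the slice at [t]; the index set [D] is cut down
   to them. *)
apply: le_trans (IH [set k | D k /\ A k n <= t <= B k n] _) _.
  move=> p pab.
  have [|k Dk kp] := cov (fun i => if i == n then t else p i).
    move=> i; rewrite ltnS leq_eqVlt; case: eqVneq => [->//|/= _ iltn].
    exact: pab.
  exists k.
    by split=> //; have := kp n; rewrite eqxx; apply.
  move=> i iltn; have := kp i; rewrite ltn_eqF//; apply.
  exact: ltnW.
apply: lee_nneseries => [k _ _|k _]; first by rewrite lee_fin mulr_ge0 ?vol_ge0.
rewrite lee_fin /c mulrAC ler_wpM2r ?vol_ge0//.
rewrite !indicE -natrM mulnb ler_nat.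
case: (boolP (k \in _)) => //; rewrite inE => -[Dk kt].
by rewrite mem_set// mem_set//= in_itv.
Qed.

End BoxCover.

(** * Time slices of null sets of space-time *)

Section NullSlices.
Context {R : realType} {N : nat}.
Local Notation mu := (@lebesgue_measure R).
Local Notation vec := 'rV[R]_N.

Definition seqrv (p : nat -> R) : vec := \row_(i < N) p i.
Definition rvseq (v : vec) : nat -> R :=
  fun i => if insub i is Some j then v ord0 j else 0.

Lemma rvseqE (v : vec) (i : 'I_N) : rvseq v i = v ord0 i.
Proof. by rewrite /rvseq valK. Qed.

Lemma boxvolE (a b : R * vec) :
  boxvol a b = vol N (rvseq a.2) (rvseq b.2) * Num.max 0 (b.1 - a.1).
Proof.
rewrite /boxvol mulrC; congr (_ * _); apply: eq_bigr => i _.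
by rewrite !rvseqE.
Qed.

(** The total volume [g n t] of the slices at time [t] of the n-th cover has integral at most
    1/(n+1). Where the slice of [E] contains the fixed box, [g n t] is at least the volume of that
    box. By Markov's inequality such times lie, for every n, in a set [S n] of measure at most a
    fixed multiple of 1/(n+1). *)
Lemma null_set_slice (E : set (R * vec)) (a b : nat -> R) :
  Defs.null_set E -> 0 < vol N a b ->
  mu.-negligible [set t | forall p, inbox N a b p -> E (t, seqrv p)].
Proof.
move=> nullE v0.
have /choice[AB HAB] : forall n : nat, exists AB : nat -> (R * vec) * (R * vec),
    E `<=` \bigcup_k box (AB k).1 (AB k).2 /\
    forall m, \sum_(k < m) boxvol (AB k).1 (AB k).2 <= n.+1%:R^-1.
  move=> n; have [|A [B [H1 H2]]] := nullE n.+1%:R^-1; first by rewrite invr_gt0.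
  by exists (fun k => (A k, B k)).
pose lo n k := (AB n k).1; pose hi n k := (AB n k).2.
pose c n k := vol N (rvseq (lo n k).2) (rvseq (hi n k).2).
have c0 n k : 0 <= c n k by exact: vol_ge0.
pose g n t := (\sum_(k <oo) (c n k * \1_(`[(lo n k).1, (hi n k).1]%classic) t)%:E)%E.
have mg n : measurable_fun setT (g n) by exact: measurable_nneseries_itv.
pose S n := [set t | ((vol N a b)%:E <= g n t)%E].
have mS n : measurable (S n).
  by rewrite -[S n]setTI; apply: emeasurable_fun_c_infty.
have muS n : (mu (S n) <= (n.+1%:R^-1 / vol N a b)%:E)%E.
  rewrite EFinM lee_pdivlMr//.
  rewrite muleC -integral_cst; last exact: mS.
  apply: (@le_trans _ _ (\int[mu]_(t in S n) g n t)%E).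
    apply: ge0_le_integral => //.
    - exact: mS.
    - by move=> t _; rewrite /= lee_fin ltW.
    - exact: measurable_funS (mg n).
  apply: le_trans (integral_nneseries_itv_le _ _ _ _) _ => //.
  apply: lime_le.
    by apply: is_cvg_nneseries => k _ _; rewrite lee_fin mulr_ge0// le_max lexx.
  near=> m; rewrite big_mkord sumEFin lee_fin.
  by under eq_bigr do rewrite -boxvolE; exact: (HAB n).2.
exists (\bigcap_n S n); split.
- by apply: bigcapT_measurable.
- apply/eqP; rewrite -measure_le0; apply/lee_addgt0Pr => e e0; rewrite add0e.
  have [n ne] : exists n : nat, n.+1%:R^-1 / vol N a b <= e.
    exists (Num.truncn (e * vol N a b)^-1).
    rewrite ler_pdivrMr// -[leRHS]invrK lef_pV2 ?posrE ?invr_gt0 ?mulr_gt0//.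
    by apply/ltW; rewrite truncnS_gt.
  apply: (@le_trans _ _ (n.+1%:R^-1 / vol N a b)%:E); last by rewrite lee_fin.
  apply: le_trans (muS n).
  apply: le_measure; rewrite ?inE; [exact: bigcapT_measurable|exact: mS|].
  exact: bigcap_inf.
- move=> t /= Ht n _ /=.
  pose D := [set k | (lo n k).1 <= t <= (hi n k).1].
  apply: le_trans (@vol_le_cover _ N a b (fun k => rvseq (lo n k).2)
     (fun k => rvseq (hi n k).2) D _) _.
    move=> p /Ht /((HAB n).1) [k _ [/= tk pk]]; exists k => // i iN.
    by have := pk (Ordinal iN); rewrite mxE -!rvseqE.
  apply: lee_nneseries => [k _ _|k _]; first by rewrite lee_fin mulr_ge0 ?vol_ge0.
  by rewrite lee_fin mulrC ler_wpM2l ?vol_ge0.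
Unshelve. all: by end_near. Qed.

End NullSlices.

(** * The dissipativity inequality at almost every time, for all points of a cube *)

Section Dissipativity.
Context {R : realType} {N : nat}.
Local Notation mu := (@lebesgue_measure R).
Local Notation vec := 'rV[R]_N.

(** If the complement of a slice is not dense, the slice contains a cube with rational lower corner
    and side 1/(k+1). There are countably many such cubes, and each is contained in the slice only
    for a negligible set of times. *)
Lemma null_set_slice_dense (E : set (R * vec)) :
  Defs.null_set E ->
  {ae mu, forall t, forall (x : vec) (e : R), 0 < e ->
    exists2 y, ~ E (t, y) & forall i, `|y ord0 i - x ord0 i| <= e}.
Proof.
move=> nullE.
pose lo (c : seq rat * nat) i : R := ratr (nth 0 c.1 i).
pose hi (c : seq rat * nat) i : R := lo c i + c.2.+1%:R^-1.
pose F n := if unpickle n is Some c then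
  [set t | forall p, inbox N (lo c) (hi c) p -> E (t, seqrv p)] else set0.
rewrite /almost_everywhere.
apply: (@negligibleS _ _ _ mu (\bigcup_n F n)); last first.
  apply: negligible_bigcup => n; rewrite /F; case: unpickle => [c|]; last first.
    exact: negligible_set0.
  apply: null_set_slice => //; apply: prodr_gt0 => i _.
  by rewrite lt_max addrAC subrr add0r invr_gt0 ltr0n orbT.
move=> t /= Ht; apply: contrapT => tF; apply: Ht => x e e0.
pose k := Num.truncn (e / 2)^-1.
have ke : k.+1%:R^-1 <= e / 2.
  rewrite -[leRHS]invrK lef_pV2 ?posrE ?invr_gt0 ?divr_gt0//.
  by apply/ltW; rewrite truncnS_gt.
(* The corner lies less than e/2 below [x] and the side is at most e/2, so the cube stays within e
   of [x]. *)
have /choice[q Hq] : forall i : nat, exists q : rat,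
    rvseq x i - e / 2 < ratr q < rvseq x i.
  move=> i; have [|q] := @rat_in_itvoo R (rvseq x i - e / 2) (rvseq x i).
    by rewrite ltrBlDr ltrDl divr_gt0.
  by rewrite in_itv/= => ?; exists q.
pose c := (mkseq q N, k).
apply: contrapT => nex; apply: tF; exists (pickle c) => //.
rewrite /F pickleK /= => p pbox; apply: contrapT => nE; apply: nex.
exists (seqrv p) => // i; rewrite mxE.
have := pbox i (ltn_ord i); rewrite /lo /hi /= /lo /= nth_mkseq//.
have /andP[] := Hq i; rewrite rvseqE => h1 h2 /andP[h3 h4].
have {}h4 := le_trans h4 (lerD (lexx _) ke).
rewrite ler_norml; apply/andP; split; lra.
Qed.

Lemma dotv_ge0 (x : vec) : 0 <= dotv x x.
Proof. by apply: sumr_ge0 => i _; rewrite -expr2 sqr_ge0. Qed.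

Lemma enorm_sqr (x : vec) : enorm x ^+ 2 = dotv x x.
Proof. by rewrite sqr_sqrtr ?dotv_ge0. Qed.

Lemma normr_coord_le_enorm (x : vec) i : `|x ord0 i| <= enorm x.
Proof.
rewrite -sqrtr_sqr ler_sqrt ?dotv_ge0// /dotv (bigD1 i)//= expr2 lerDl.
by apply: sumr_ge0 => j _; rewrite -expr2 sqr_ge0.
Qed.

Lemma enorm_le_coord (x : vec) (d : R) : 0 <= d ->
  (forall i, `|x ord0 i| <= d) -> enorm x <= N%:R * d.
Proof.
move=> d0 xd; rewrite -(@ger0_norm _ (N%:R * d)) ?mulr_ge0// -sqrtr_sqr.
rewrite ler_sqrt ?sqr_ge0//.
apply: (@le_trans _ _ (\sum_(i < N) d ^+ 2)).
  apply: ler_sum => i _; rewrite -expr2 -real_normK ?num_real//.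
  by rewrite lerXn2r ?nnegrE.
rewrite sumr_const card_ord exprMn -[leLHS]mulr_natl ler_wpM2r ?sqr_ge0//.
by rewrite -natrX ler_nat; case: (N) => // n; rewrite leq_pmulr.
Qed.

(** The exceptional times do not depend on [x], so the inequality can later be evaluated along a
    solution. It is obtained as a limit over points outside [E] tending to [x]. *)
Lemma H1_ae (f : R -> vec -> vec) (alpha beta : R -> R) (M : R) :
  LC f -> H1 f alpha beta ->
  {ae mu, forall t, forall x : vec, (forall i, `|x ord0 i| <= M) ->
    2 * dotv (f t x) x <= alpha t * dotv x x + beta t}.
Proof.
move=> [_ lcf] [_ [_ [_ [E [nullE HE]]]]].
(* The margin 1 makes room for the approximating points [y n], whose coordinates differ from those
   of [x] by at most 1. *)
pose K := [set v : vec | forall i, `[- (M + 1), M + 1]%classic (v ord0 i)].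
have cK : compact K.
  apply: (@rV_compact R N (fun=> `[- (M + 1), M + 1]%classic)) => i.
  exact: segment_compact.
have [m [l [_ [_ HK]]]] := lcf K cK.
apply: (@filterS2 _ _ (ae_filter_ringOfSetsType mu) _ _ _ _ HK
  (null_set_slice_dense nullE)) => t {}HK dense x xM.
have Kx : K x.
  move=> i /=; rewrite in_itv/= -ler_norml.
  by rewrite (le_trans (xM i))// lerDl.
have /choice[y Hy] : forall n : nat, exists y : vec, ~ E (t, y) /\
    forall i, `|y ord0 i - x ord0 i| <= n.+1%:R^-1.
  move=> n; have [|y yE yx] := dense x n.+1%:R^-1; first by rewrite invr_gt0.
  by exists y.
have Ky n : K (y n).
  move=> i /=; rewrite in_itv/= -ler_norml.
  have -> : y n ord0 i = x ord0 i + (y n ord0 i - x ord0 i) by ring.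
  rewrite (le_trans (ler_normD _ _))// lerD// (le_trans ((Hy n).2 i))//.
  by rewrite invf_le1// ler1n.
have cvg_bound (u : nat -> R) (v C : R) :
    (forall n, `|u n - v| <= C * n.+1%:R^-1) -> u @ \oo --> v.
  move=> uv; apply/subr_cvg0; apply: norm_cvg0.
  apply: (@squeeze_cvgr _ \oo _ R (fun=> 0) (fun n => C * harmonic n)
    (fun n => `|u n - v|)).
  - by apply: nearW => n; rewrite normr_ge0 uv.
  - exact: cvg_cst.
  - rewrite -[X in _ --> X](mulr0 C); apply: cvgM; first exact: cvg_cst.
    exact: cvg_harmonic.
have cvy i : (fun n => y n ord0 i) @ \oo --> x ord0 i.
  by apply: (cvg_bound _ _ 1) => n; rewrite mul1r; exact: (Hy n).2.
have cvf i : (fun n => f t (y n) ord0 i) @ \oo --> f t x ord0 i.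
  (* The absolute value appears because [LC] does not fix the sign of [l t]. *)
  apply: (cvg_bound _ _ (`|l t| * N%:R)) => n.
  have := normr_coord_le_enorm (f t (y n) - f t x) i; rewrite !mxE => /le_trans.
  apply; apply: le_trans (HK _ _ (Ky n) Kx).2 _.
  apply: (@le_trans _ _ (`|l t| * enorm (y n - x))).
    by rewrite ler_wpM2r ?sqrtr_ge0// ler_norm.
  rewrite -mulrA ler_wpM2l//; apply: enorm_le_coord => // i'.
  by rewrite !mxE; exact: (Hy n).2.
have cvdot (u v : nat -> vec) (u' v' : vec) :
    (forall i, (fun n => u n ord0 i) @ \oo --> u' ord0 i) ->
    (forall i, (fun n => v n ord0 i) @ \oo --> v' ord0 i) ->
    (fun n => dotv (u n) (v n)) @ \oo --> dotv u' v'.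
  move=> uu vv; apply: cvg_big => [|i _]; first exact: add_continuous.
  exact: cvgM.
apply: (@ler_cvg_to _ \oo _ _ (fun n => 2 * dotv (f t (y n)) (y n))
  (fun n => alpha t * dotv (y n) (y n) + beta t)).
- by apply: cvgM; [exact: cvg_cst|exact: cvdot].
- apply: cvgD; last exact: cvg_cst.
  by apply: cvgM; [exact: cvg_cst|exact: cvdot].
- by apply: nearW => n; rewrite -enorm_sqr; apply: HE; exact: (Hy n).1.
Qed.

End Dissipativity.

(** * Sums and almost everywhere comparison of real integrals *)

Section RealIntegrals.
Context d (T : measurableType d) (R : realType).
Variables (mu : {measure set T -> \bar R}) (D : set T) (mD : measurable D).
Implicit Types f g : T -> R.

Lemma integrable_EFinD f g :
  mu.-integrable D (EFin \o f) -> mu.-integrable D (EFin \o g) ->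
  mu.-integrable D (EFin \o (fun x => f x + g x)).
Proof.
by move=> hf hg; exact: (integrableD mD hf hg).
Qed.

Lemma integrable_EFinZ (k : R) f :
  mu.-integrable D (EFin \o f) ->
  mu.-integrable D (EFin \o (fun x => k * f x)).
Proof.
by move=> hf; exact: (integrableZl mD k hf).
Qed.

Lemma integrable_EFin_sum n (F : 'I_n -> T -> R) :
  (forall i, mu.-integrable D (EFin \o F i)) ->
  mu.-integrable D (EFin \o (fun x => \sum_(i < n) F i x)).
Proof.
move=> hF; have := @integrable_sum _ _ _ mu _ mD _ (index_enum 'I_n) xpredT _
  (fun i _ => hF i).
by apply: eq_integrable => // x _; rewrite /= sumEFin.
Qed.

Lemma Rintegral_sum n (F : 'I_n -> T -> R) :
  (forall i, mu.-integrable D (EFin \o F i)) ->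
  \int[mu]_(x in D) (\sum_(i < n) F i x) = \sum_(i < n) \int[mu]_(x in D) F i x.
Proof.
elim: n F => [|n IH] F hF.
  rewrite big_ord0; under eq_Rintegral do rewrite big_ord0.
  by rewrite /Rintegral integral0.
rewrite big_ord_recr/=; under eq_Rintegral do rewrite big_ord_recr/=.
by rewrite RintegralD ?IH//; exact: integrable_EFin_sum.
Qed.

(** Almost everywhere on [D] the difference [g - f] agrees with its absolute value, so both have the
    same, nonnegative, integral. *)
Lemma ae_le_Rintegral f g :
  mu.-integrable D (EFin \o f) -> mu.-integrable D (EFin \o g) ->
  {ae mu, forall x, D x -> f x <= g x} ->
  \int[mu]_(x in D) f x <= \int[mu]_(x in D) g x.
Proof.
move=> hf hg fg; rewrite -subr_ge0 -RintegralB//.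
have hgf : mu.-integrable D (EFin \o (fun x => g x - f x)).
  exact: (integrableB mD hg hf).
suff -> : \int[mu]_(x in D) (g x - f x) = \int[mu]_(x in D) `|g x - f x|.
  exact: Rintegral_ge0.
congr fine; apply: ae_eq_integral => //.
- exact: (measurable_int mu).
- exact: (measurable_int mu (integrable_norm hgf)).
- apply: (@filterS _ _ (ae_filter_ringOfSetsType mu) _ _ _ fg) => x fgx Dx.
  by rewrite ger0_norm// subr_ge0 fgx.
Qed.
End RealIntegrals.

(** * Integrals over adjacent intervals, and monotonicity from local estimates *)

Section Gronwall.
Context {R : realType}.
Local Notation mu := (@lebesgue_measure R).

Lemma integrable_sub_itv (f : R -> R) (a b s t : R) : a <= s -> t <= b ->
  mu.-integrable `[a, b] (EFin \o f) -> mu.-integrable `[s, t] (EFin \o f).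
Proof.
move=> as_ tb; apply: integrableS => //; apply: subset_itv;
  by rewrite bnd_simp.
Qed.

Lemma Rintegral_itv_split (f : R -> R) (a s t : R) : a <= s -> s <= t ->
  mu.-integrable `[a, t] (EFin \o f) ->
  \int[mu]_(w in `[a, t]) f w =
  \int[mu]_(w in `[a, s]) f w + \int[mu]_(w in `[s, t]) f w.
Proof.
move=> as_ st hf.
have -> : \int[mu]_(w in `[s, t]) f w = \int[mu]_(w in `]s, t]) f w.
  rewrite Rintegral_itv_obnd_cbnd//.
  by apply: integrableS hf => //; apply: subset_itv; rewrite bnd_simp.
rewrite -(@Rintegral_itvB _ f (BLeft a) (BRight t) s)//; first by ring.
Qed.

(** Let c be the supremum of the points of [a, b] where [G] is at most [G a]. The local estimate at
    c shows first that c is such a point, then, if c < b, that so is a point beyond c, which is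
    absurd. *)
Lemma local_nonincreasing_le (G : R -> R) (a b : R) : a <= b ->
  (forall c, a <= c <= b -> exists2 e, 0 < e & forall s t,
     a <= s -> s <= c -> c <= t -> t <= b -> c - e < s -> t < c + e ->
     G t <= G s) ->
  G b <= G a.
Proof.
move=> ab loc.
pose S := [set t | a <= t <= b /\ G t <= G a].
have Sa : S a by rewrite /S /= lexx ab.
have supS : has_sup S by split; [exists a|exists b => t [/andP[]]].
pose c := sup S.
have acb : a <= c <= b.
  rewrite (ub_le_sup supS.2 Sa)/=.
  by apply: ge_sup; [exists a|move=> t [/andP[]]].
have [e e0 He] := loc c acb; have /andP[ac cb] := acb.
have [s [/andP[as_ sb] Gs] cs] := sup_adherent e0 supS.
have sc : s <= c by apply: (ub_le_sup supS.2); split => //; rewrite as_.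
have Gc : G c <= G a.
  by apply: le_trans Gs; apply: He => //; rewrite ltrDl.
move: cb; rewrite le_eqVlt => /predU1P[<-//|cb].
pose t := Num.min b (c + e / 2).
have ct : c < t by rewrite lt_min cb ltrDl divr_gt0.
suff St : S t by have := ub_le_sup supS.2 St; rewrite leNgt ct.
have tb : t <= b by rewrite ge_min lexx.
split; first by rewrite tb (le_trans ac (ltW ct)).
apply: le_trans Gc; apply: He => //; first exact: ltW.
  by rewrite ltrBlDr ltrDl.
by rewrite gt_min; apply/orP; right; lra.
Qed.
End Gronwall.

(** Discrete product rule: et ut - es us = et (ut - us) + us (et - es). The terms in [dA] cancel,
    which is the effect of the integrating factor. *)
Lemma weighted_increment_le (R : realFieldType)
    (et es ut us dA Bt Bs Mt Ms eta eps L : R) :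
  et * (ut - us) <= et * (us * dA + (Bt - Bs) + eta * (Mt - Ms)) ->
  us * (et - es) <= us * (- et * dA) ->
  et * (Bt - Bs) <= L * (Bt - Bs) ->
  et * (eta * (Mt - Ms)) <= eps * (Mt - Ms) ->
  et * ut - L * Bt - eps * Mt <= es * us - L * Bs - eps * Ms.
Proof. lra. Qed.

(** * Gronwall's inequality for the squared norm *)

Section GronwallVector.
Context {R : realType} {N : nat}.
Local Notation mu := (@lebesgue_measure R).
Local Notation vec := 'rV[R]_N.
Variables (x F : R -> vec) (alpha beta : R -> R) (a b : R).
Hypothesis ab : a <= b.
Hypothesis iF : forall i,
  mu.-integrable `[a, b] (EFin \o (fun w => F w ord0 i)).
Hypothesis ialpha : mu.-integrable `[a, b] (EFin \o alpha).
Hypothesis ibeta : mu.-integrable `[a, b] (EFin \o beta).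
Hypothesis beta0 : forall t, 0 <= beta t.
Hypothesis xE : forall t i, a <= t <= b ->
  x t ord0 i = x a ord0 i + \int[mu]_(w in `[a, t]) F w ord0 i.
Hypothesis dissip : {ae mu, forall w, a <= w <= b ->
  2 * dotv (F w) (x w) <= alpha w * dotv (x w) (x w) + beta w}.

Let u t := dotv (x t) (x t).
(** Dominates both errors below: [alpha] for freezing [u] at s, [F] for replacing x(t) + x(s) by 2
    x(w). *)
Let m w : R := `|alpha w| + \sum_(i < N) `|F w ord0 i|.

Let im : mu.-integrable `[a, b] (EFin \o m).
Proof.
apply: integrable_EFinD => //; first exact: integrable_norm.
by apply: integrable_EFin_sum => // i; exact: (integrable_norm (iF i)).
Qed.

Let m0 w : 0 <= m w.
Proof. by rewrite addr_ge0// sumr_ge0. Qed.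

(** Coordinatewise difference of squares: the increment of x is an integral of [F], and the constant
    factor x(t) + x(s) moves inside it. *)
Lemma dotv_increment (s t : R) : a <= s -> s <= t -> t <= b ->
  u t - u s = \int[mu]_(w in `[s, t])
    (\sum_(i < N) (x t ord0 i + x s ord0 i) * F w ord0 i).
Proof.
move=> as_ st tb.
have iFst i : mu.-integrable `[s, t] (EFin \o (fun w => F w ord0 i)).
  exact: integrable_sub_itv (iF i).
rewrite Rintegral_sum//; last by move=> i; exact: integrable_EFinZ.
rewrite /u /dotv -sumrB; apply: eq_bigr => i _; rewrite RintegralZl//.
rewrite [in LHS](@xE t) ?(le_trans as_ st)// [in RHS](@xE t) ?(le_trans as_ st)//.
rewrite !(@xE s) ?as_ ?(le_trans st tb)//.
rewrite (@Rintegral_itv_split _ _ a s t)//; first by ring.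
exact: integrable_sub_itv (iF i).
Qed.

Lemma dotv_increment_le (s t eta : R) : a <= s -> s <= t -> t <= b ->
  (forall w, s <= w <= t -> `|u w - u s| <= eta) ->
  (forall w i, s <= w <= t ->
     `|x t ord0 i + x s ord0 i - 2 * x w ord0 i| <= eta) ->
  u t - u s <= u s * \int[mu]_(w in `[s, t]) alpha w +
    \int[mu]_(w in `[s, t]) beta w + eta * \int[mu]_(w in `[s, t]) m w.
Proof.
move=> as_ st tb uosc xosc; rewrite dotv_increment//.
have ist (f : R -> R) : mu.-integrable `[a, b] (EFin \o f) ->
  mu.-integrable `[s, t] (EFin \o f) by exact: integrable_sub_itv.
have ia := ist _ ialpha; have ib := ist _ ibeta; have im' := ist _ im.
have ia' : mu.-integrable `[s, t] (EFin \o (fun w => u s * alpha w)).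
  exact: integrable_EFinZ.
have im'' : mu.-integrable `[s, t] (EFin \o (fun w => eta * m w)).
  exact: integrable_EFinZ.
have iab : mu.-integrable `[s, t] (EFin \o (fun w => u s * alpha w + beta w)).
  exact: integrable_EFinD.
rewrite -RintegralZl// -RintegralD// -RintegralZl// -RintegralD//.
apply: ae_le_Rintegral => //.
- apply: integrable_EFin_sum => // i; apply: integrable_EFinZ => //.
  exact: (ist _ (iF i)).
- exact: integrable_EFinD.
apply: (@filterS _ _ (ae_filter_ringOfSetsType mu) _ _ _ dissip) => w Hw.
rewrite /= in_itv/= => swt; have /andP[sw wt] := swt.
have {}Hw := Hw (introT andP (conj (le_trans as_ sw) (le_trans wt tb))).
have h1 : \sum_(i < N) (x t ord0 i + x s ord0 i) * F w ord0 i <=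
    2 * dotv (F w) (x w) + eta * \sum_(i < N) `|F w ord0 i|.
  rewrite /dotv !mulr_sumr -big_split /=; apply: ler_sum => i _.
  rewrite -lerBlDl.
  have -> : (x t ord0 i + x s ord0 i) * F w ord0 i -
    2 * (F w ord0 i * x w ord0 i) =
    (x t ord0 i + x s ord0 i - 2 * x w ord0 i) * F w ord0 i by ring.
  by rewrite (le_trans (ler_norm _))// normrM ler_wpM2r// xosc.
have h2 : alpha w * (u w - u s) <= eta * `|alpha w|.
  by rewrite (le_trans (ler_norm _))// normrM mulrC ler_wpM2r// uosc.
apply: le_trans h1 _; rewrite /m mulrDr -/(u w) in Hw *.
have := Hw; rewrite -/(u w) => {}Hw.
move: h2; rewrite mulrBr => h2; lra.
Qed.

(** Each coordinate is an indefinite integral, hence continuous on [a, b]; one [e] serves the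
    finitely many coordinates and [u] together. *)
Lemma dotv_continuous (c eta : R) : a <= c <= b -> 0 < eta ->
  exists2 e : R, 0 < e & forall w, a <= w <= b -> `|w - c| < e ->
    `|u w - u c| <= eta /\ forall i, `|x w ord0 i - x c ord0 i| <= eta.
Proof.
move=> acb eta0.
have cx i : (fun w => x w ord0 i) @ within `[a, b]%classic (nbhs c) --> x c ord0 i.
  have := parameterized_integral_continuous ab (iF i).
  move/subspace_continuousP => /(_ c); rewrite /= in_itv/= => /(_ acb) h.
  rewrite [X in _ --> X](xE _ acb).
  have h' : (fun w => x a ord0 i +
     parameterized_integral mu a w (fun w => F w ord0 i))
     @ within `[a, b]%classic (nbhs c) -->
     x a ord0 i + \int[mu]_(w in `[a, c]) F w ord0 i.
    by apply: cvgD => //; exact: cvg_cst.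
  apply: cvg_trans h'; apply: near_eq_cvg; near=> w.
  rewrite /parameterized_integral -xE//.
  have : `[a, b]%classic w by near: w; exact: withinT.
  by rewrite /= in_itv.
have cu : u @ within `[a, b]%classic (nbhs c) --> u c.
  apply: cvg_big => [|i _]; first exact: add_continuous.
  exact: cvgM.
have nu := cvgr_dist_le u (u c) cu eta eta0.
have nx := filter_forall _ (fun i => cvgr_dist_le _ _ (cx i) eta eta0).
have FF : Filter (within `[a, b]%classic (nbhs c)) by apply: within_filter.
have [e /= e0 He] := filterI (nu FF) (nx FF FF).
exists e => // w wab wc.
have [||h1 h2] := He w.
- by rewrite /ball_ /= distrC.
- by rewrite /= in_itv.
- by split=> [|i]; rewrite distrC// h2.
Unshelve. all: by end_near. Qed.

(** With the integrating factor [e], the function [G] is nonincreasing for every eps > 0, by the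
    local criterion; then eps tends to 0. The bound [L] enters through e(t) / e(b), the exponential
    of the integral of [alpha] over [t, b]. *)
Lemma dotv_gronwall (L : R) :
  (forall s, a <= s <= b -> expR (\int[mu]_(w in `[s, b]) alpha w) <= L) ->
  dotv (x b) (x b) <=
    expR (\int[mu]_(w in `[a, b]) alpha w) * dotv (x a) (x a) +
    L * \int[mu]_(w in `[a, b]) beta w.
Proof.
move=> HL.
pose A t := \int[mu]_(w in `[a, t]) alpha w.
pose B t := \int[mu]_(w in `[a, t]) beta w.
pose M t := \int[mu]_(w in `[a, t]) m w.
pose e t := expR (- A t).
have eL t : a <= t <= b -> e t <= L * e b.
  move=> /[dup] tab /andP[at_ tb]; rewrite -ler_pdivrMr ?expR_gt0//.
  apply: le_trans (HL t tab); rewrite /e -expRN -expRD ler_expR.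
  by rewrite /A (@Rintegral_itv_split _ _ a t b)//; lra.
have Leb0 : 0 < L * e b.
  by apply: lt_le_trans (eL b _); rewrite ?expR_gt0// ab lexx.
have key eps : 0 < eps -> e b * u b <= u a + L * e b * B b + eps * M b.
  move=> eps0.
  pose G t := e t * u t - L * e b * B t - eps * M t.
  have Ga : G a = u a.
    by rewrite /G /e /A /B /M set_itv1 !Rintegral_set1 oppr0 expR0 !mulr0 !subr0 mul1r.
  suff : G b <= G a by rewrite Ga /G; lra.
  apply: local_nonincreasing_le => // c acb.
  (* This gives [e t * eta <= eps]. The quarter below is needed because x(t) + x(s) - 2 x(w),
     compared through c, collects four deviations. *)
  pose eta := eps / (L * e b).
  have eta0 : 0 < eta by rewrite divr_gt0.
  have eta40 : 0 < eta / 4 by rewrite divr_gt0.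
  have [d d0 Hd] := dotv_continuous acb eta40.
  exists d => // s t as_ sc ct tb cs tc.
  have st := le_trans sc ct; have at_ := le_trans as_ st.
  have sb := le_trans st tb.
  have osc w : s <= w <= t -> `|u w - u c| <= eta / 4 /\
      forall i, `|x w ord0 i - x c ord0 i| <= eta / 4.
    move=> /andP[sw wt]; apply: Hd; first by rewrite (le_trans as_ sw) (le_trans wt tb).
    by rewrite ltr_norml; apply/andP; split; lra.
  have oscs := osc s (introT andP (conj (lexx s) st)).
  have osct := osc t (introT andP (conj st (lexx t))).
  have := @dotv_increment_le s t eta as_ st tb.
  have -> : \int[mu]_(w in `[s, t]) alpha w = A t - A s.
    rewrite /A (@Rintegral_itv_split _ _ a s t)//; first by rewrite addrAC subrr add0r.
    exact: integrable_sub_itv ialpha.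
  have EB : \int[mu]_(w in `[s, t]) beta w = B t - B s.
    rewrite /B (@Rintegral_itv_split _ _ a s t)//; first by rewrite addrAC subrr add0r.
    exact: integrable_sub_itv ibeta.
  have EM : \int[mu]_(w in `[s, t]) m w = M t - M s.
    rewrite /M (@Rintegral_itv_split _ _ a s t)//; first by rewrite addrAC subrr add0r.
    exact: integrable_sub_itv im.
  have Bst : 0 <= B t - B s by rewrite -EB; exact: Rintegral_ge0.
  have Mst : 0 <= M t - M s by rewrite -EM; exact: Rintegral_ge0.
  rewrite EB EM => incr.
  have {}incr : u t - u s <= u s * (A t - A s) + (B t - B s) + eta * (M t - M s).
    apply: incr => [w|w i] swt.
      have [h1 _] := osc w swt; have [h2 _] := oscs.
      move: h1 h2; rewrite !ler_norml => /andP[? ?] /andP[? ?].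
      by apply/andP; split; lra.
    have := (osc w swt).2 i; have := oscs.2 i; have := osct.2 i.
    rewrite !ler_norml => /andP[? ?] /andP[? ?] /andP[? ?].
    by apply/andP; split; lra.
  have et0 : 0 < e t by exact: expR_gt0.
  have etL : e t <= L * e b by apply: eL; rewrite at_.
  (* This is 1 + y <= exp y at y = A(t) - A(s), multiplied by e(t). *)
  have ediff : e t - e s <= - e t * (A t - A s).
    have -> : e s = e t * expR (A t - A s) by rewrite /e -expRD; congr expR; ring.
    rewrite -{1}[e t]mulr1 -mulrBr mulNr -mulrN ler_wpM2l ?(ltW et0)//.
    by rewrite lerBlDr addrC lerBrDr expR_ge1Dx.
  have h1 := ler_wpM2l (ltW et0) incr.
  have h2 := ler_wpM2l (dotv_ge0 (x s)) ediff.
  have h3 : e t * (B t - B s) <= L * e b * (B t - B s) by rewrite ler_wpM2r.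
  have h4 : e t * (eta * (M t - M s)) <= eps * (M t - M s).
    rewrite mulrA ler_wpM2r// /eta mulrCA ler_piMr ?(ltW eps0)//.
    by rewrite ler_pdivrMr// mul1r.
  exact: (weighted_increment_le h1 h2 h3 h4).
have main : e b * u b <= u a + L * e b * B b.
  apply/ler_addgt0Pr => eps eps0.
  have M0 : 0 <= M b by exact: Rintegral_ge0.
  (* The 1 keeps the denominator positive when [M b] vanishes. *)
  apply: le_trans (key (eps / (M b + 1)) _) _; first by rewrite divr_gt0// ltr_wpDl.
  rewrite lerD2l mulrAC ler_pdivrMr ?ltr_wpDl//.
  by rewrite ler_wpM2l ?lerDl// ltW.
have := ler_wpM2l (expR_ge0 (A b)) main.
have Eb : expR (A b) * e b = 1 by rewrite /e -expRD subrr expR0.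
rewrite mulrA Eb mul1r mulrDr => /le_trans; apply.
have -> : expR (A b) * (L * e b * B b) = expR (A b) * e b * (L * B b) by ring.
by rewrite Eb mul1r.
Qed.

End GronwallVector.

(** * Translation of integrals and monotonicity in the interval *)

Section Translation.
Context {R : realType}.
Local Notation mu := (@lebesgue_measure R).

Lemma preimage_addr_itv (c : R) (b1 b2 : bool) (a b : R) :
  (fun s => s + c) @^-1` [set` Interval (BSide b1 a) (BSide b2 b)] =
  [set` Interval (BSide b1 (a - c)) (BSide b2 (b - c))].
Proof.
by apply/seteqP; split=> s /=; rewrite !itv_boundlr /=;
  case: b1 b2 => -[]; rewrite !bnd_simp ?lerBlDr ?ltrBlDr ?lerBrDr ?ltrBrDr.
Qed.

(** The translated measure gives bounded intervals their length, which characterises Lebesgue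
    measure. *)
Lemma lebesgue_measure_translate (c : R) (A : set R) : measurable A ->
  pushforward mu ((fun s => s + c) : _ -> measurableTypeR R) A = mu A.
Proof.
move=> mA; apply/esym/lebesgue_measure_unique => //=.
  exact: measurable_funD.
move=> mphi _ [[a b]] _ <-.
rewrite /pushforward preimage_addr_itv !lebesgue_measure_itv/= !lte_fin ltrD2r.
by case: ifP => // _; rewrite -!EFinB; congr EFin; ring.
Qed.

Lemma ge0_Rintegral_translate (g : R -> R) (a b c : R) :
  mu.-integrable `[a, b] (EFin \o g) -> (forall t, 0 <= g t) ->
  \int[mu]_(s in `[a - c, b - c]) g (s + c) = \int[mu]_(s in `[a, b]) g s.
Proof.
move=> ig g0; rewrite /Rintegral; congr fine.
rewrite -[X in integral _ X _](@preimage_addr_itv c true false a b).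
pose phi : measurableTypeR R -> measurableTypeR R := fun s => s + c.
have mphi : measurable_fun setT phi by exact: measurable_funD.
rewrite -(ge0_integral_pushforward mphi mu (D := `[a, b]%classic)
  (f := fun y => (g y)%:E))//.
- by apply: eq_measure_integral => //= A mA _; exact: lebesgue_measure_translate.
- exact: (measurable_int mu).
- by move=> y _; rewrite lee_fin.
Qed.

Lemma ge0_le_Rintegral_itv (g : R -> R) (a b s t : R) :
  mu.-integrable `[a, b] (EFin \o g) -> (forall w, 0 <= g w) ->
  a <= s -> s <= t -> t <= b ->
  \int[mu]_(w in `[s, t]) g w <= \int[mu]_(w in `[a, b]) g w.
Proof.
move=> ig g0 as_ st tb.
rewrite (@Rintegral_itv_split _ _ a s b) ?(le_trans st tb)//.
rewrite (@Rintegral_itv_split _ _ s t b)//; last exact: integrable_sub_itv ig.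
have h1 : 0 <= \int[mu]_(w in `[a, s]) g w by exact: Rintegral_ge0.
have h2 : 0 <= \int[mu]_(w in `[t, b]) g w by exact: Rintegral_ge0.
by rewrite (le_trans _ (lerD h1 (lexx _)))// add0r lerDl.
Qed.
End Translation.

(** * Gronwall's inequality along solutions *)

Section Solutions.
Context {R : realType} {N : nat}.
Local Notation mu := (@lebesgue_measure R).
Local Notation vec := 'rV[R]_N.
Variables (f : R -> vec -> vec) (alpha beta : R -> R).
Hypotheses (lcf : LC f) (h1f : H1 f alpha beta).

Lemma solution_gronwall (r : R) (x0 : vec) (x : R -> vec) (a b L : R) :
  is_solution f r x0 x -> r <= a -> a <= b ->
  (forall s, a <= s <= b -> expR (\int[mu]_(w in `[s, b]) alpha w) <= L) ->
  dotv (x b) (x b) <=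
    expR (\int[mu]_(w in `[a, b]) alpha w) * dotv (x a) (x a) +
    L * \int[mu]_(w in `[a, b]) beta w.
Proof.
move=> [_ solx] ra ab; have rb := le_trans ra ab.
have iFr i : mu.-integrable `[r, b] (EFin \o (fun w => f w (x w) ord0 i)).
  exact: (solx b rb i).1.
have [ialpha [ibeta [beta0 _]]] := h1f.
(* Bounds every coordinate of the solution on [r, b], so one application of [H1_ae] covers the whole
   trajectory there. *)
pose M := \sum_(i < N)
  (`|x0 ord0 i| + \int[mu]_(w in `[r, b]) `|f w (x w) ord0 i|).
apply: (@dotv_gronwall _ _ x (fun w => f w (x w))) => //.
- by move=> i; exact: integrable_sub_itv (iFr i).
- move=> t i /andP[at_ tb].
  rewrite (solx t (le_trans ra at_) i).2 (solx a ra i).2.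
  rewrite (@Rintegral_itv_split _ _ r a t) ?addrA//.
  exact: integrable_sub_itv (iFr i).
apply: (@filterS _ _ (ae_filter_ringOfSetsType mu) _ _ _
  (@H1_ae _ _ f alpha beta M lcf h1f)) => w Hw /andP[aw wb].
apply: Hw => i; have rw := le_trans ra aw.
have iabs := integrable_norm (iFr i).
have abs0 j : 0 <= \int[mu]_(w in `[r, b]) `|f w (x w) ord0 j|.
  exact: Rintegral_ge0.
rewrite (solx w rw i).2 /M (bigD1 i)//=.
apply: (@le_trans _ _ (`|x0 ord0 i| + \int[mu]_(w in `[r, b]) `|f w (x w) ord0 i|)).
  apply: le_trans (ler_normD _ _) _; rewrite lerD2l.
  have iw : mu.-integrable `[r, w] (EFin \o (fun w => f w (x w) ord0 i)).
    exact: integrable_sub_itv (iFr i).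
  apply: le_trans (le_normr_Rintegral _ iw) _ => //.
  by apply: ge0_le_Rintegral_itv => //.
by rewrite lerDl sumr_ge0// => j _; rewrite addr_ge0.
Qed.

End Solutions.

(** * From Gronwall's inequality to ultimate bounds *)

Section UltimateBound.
Context {R : realType}.
Local Notation mu := (@lebesgue_measure R).

(* The abstract estimate satisfied by u = |x|^2 along a solution x. *)
Definition gronwall_on (r : R) (alpha beta u : R -> R) :=
  forall a b L, r <= a -> a <= b ->
    (forall s, a <= s <= b -> expR (\int[mu]_(w in `[s, b]) alpha w) <= L) ->
    u b <= expR (\int[mu]_(w in `[a, b]) alpha w) * u a +
      L * \int[mu]_(w in `[a, b]) beta w.

(** The interval of radius [len] about a contains [a, b], and translating it to the origin gives the
    integral bounded in [H3]. *)
Lemma H3_window (beta : R -> R) (len : R) :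
  locint beta -> (forall t, 0 <= beta t) -> H3 beta -> 0 < len ->
  exists2 C, 0 <= C & forall a b, a <= b -> b <= a + len ->
    \int[mu]_(w in `[a, b]) beta w <= C.
Proof.
move=> ibeta beta0 h3 len0; have [C HC] := h3 len len0.
have HC' t : \int[mu]_(w in `[t - len, t + len]) beta w <= C.
  rewrite -(@ge0_Rintegral_translate _ _ _ _ t)//.
  have -> : t - len - t = - len by ring.
  by have -> : t + len - t = len by ring.
exists C; first by apply: le_trans (HC' 0); exact: Rintegral_ge0.
move=> a b ab bal; apply: le_trans (HC' a); apply: ge0_le_Rintegral_itv => //.
by rewrite gerBl ltW.
Qed.

(** The errors form a geometric series B + B/2 + ..., bounded by 2B. *)
Lemma halving_iter (u : R -> R) (a len B : R) :
  0 <= len -> 0 <= B ->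
  (forall s, a <= s -> u (s + len) <= u s / 2 + B) ->
  forall n, u (a + n%:R * len) <= u a / 2 ^+ n + 2 * B.
Proof.
move=> len0 B0 step; elim=> [|n IH].
  by rewrite mul0r addr0 expr0 divr1 lerDl mulr_ge0.
have -> : a + n.+1%:R * len = a + n%:R * len + len.
  by rewrite -natr1 mulrDl mul1r addrA.
apply: le_trans (step _ _) _; first by rewrite lerDl mulr_ge0.
have -> : u a / 2 ^+ n.+1 = u a / 2 ^+ n / 2 by rewrite exprSr invfM mulrA.
set z := u a / 2 ^+ n in IH *; lra.
Qed.

(** The time from a to t is split into m full windows, each halving [u], and a remainder shorter
    than one window, which costs at most a factor [K]. The start satisfies 0 <= a because [H2star]
    concerns nonnegative times only. *)
Lemma gronwall_ultimate_bound (alpha beta : R -> R) :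
  locint beta -> (forall t, 0 <= beta t) -> H3 beta -> H2star alpha ->
  exists2 c, 0 < c & forall D, 0 <= D -> exists2 T, 0 < T &
    forall r u a t, gronwall_on r alpha beta u -> (forall s, 0 <= u s) ->
      r <= a -> 0 <= a -> u a <= D -> a + T <= t -> u t <= c.
Proof.
move=> ibeta beta0 h3 [al [K [al0 [K1 HK]]]].
have K0 : 0 < K by rewrite (lt_le_trans _ K1).
(* The window length makes the contraction factor K e^{-al len} equal to 1/2. *)
pose len := ln (2 * K) / al.
have len0 : 0 < len by rewrite divr_gt0// ln_gt0//; lra.
have Klen : K * expR (- al * len) = 2^-1.
  rewrite mulNr /len mulrCA divff ?gt_eqF// mulr1 expRN lnK; last first.
    by rewrite posrE mulr_gt0.
  by rewrite invfM mulrCA divff ?mulr1// gt_eqF.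
have [C C0 HC] := H3_window ibeta beta0 h3 len0.
have expK s t : 0 <= s -> s <= t ->
    expR (\int[mu]_(w in `[s, t]) alpha w) <= K.
  move=> s0 st; apply: le_trans (HK s t s0 st) _.
  rewrite ler_piMr ?(ltW K0)// -expR0 ler_expR mulNr oppr_le0.
  by rewrite mulr_ge0 ?(ltW al0)// subr_ge0.
have KC0 : 0 <= K * C by rewrite mulr_ge0// ltW.
(* The 1 bounds the decayed initial value, the second term is the accumulated halving error times
   [K], the third the error of the remainder. *)
exists (1 + K * (2 * (K * C)) + K * C).
  by rewrite !ltr_wpDr// mulr_ge0 ?(ltW K0)// mulr_ge0.
(* As n > K D and 2^n > n, the term K D / 2^m is at most 1 once m >= n. *)
move=> D D0; pose n := (Num.truncn (K * D)).+1.
exists (n%:R * len); first by rewrite mulr_gt0// ltr0n.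
move=> r u a t gw u0 ra a0 uaD ant.
have short s b : a <= s -> s <= b -> b <= s + len ->
    u b <= expR (\int[mu]_(w in `[s, b]) alpha w) * u s + K * C.
  move=> as_ sb bsl.
  apply: le_trans (gw s b K (le_trans ra as_) sb _) _.
    by move=> w /andP[sw wb]; apply: expK => //; rewrite (le_trans a0)// (le_trans as_).
  by rewrite lerD2l ler_wpM2l ?(ltW K0)// HC.
have step s : a <= s -> u (s + len) <= u s / 2 + K * C.
  move=> as_; have sl : s <= s + len by rewrite lerDl ltW.
  apply: le_trans (short s (s + len) as_ sl (lexx _)) _.
  rewrite lerD2r mulrC ler_wpM2l// -Klen.
  by apply: le_trans (HK _ _ (le_trans a0 as_) sl) _; rewrite addrAC subrr add0r.
pose m := Num.truncn ((t - a) / len).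
have q0 : 0 <= (t - a) / len.
  rewrite divr_ge0 ?(ltW len0)// subr_ge0 (le_trans _ ant)// lerDl.
  by rewrite mulr_ge0// ltW.
have mle : m%:R * len <= t - a.
  by rewrite -ler_pdivlMr// truncn_le.
have mgt : t - a < m.+1%:R * len.
  by rewrite -ltr_pdivrMr// truncnS_gt.
have nm : (n <= m)%N.
  rewrite -ltnS -(ltr_nat R) -(ltr_pM2r len0) (le_lt_trans _ mgt)//.
  by rewrite lerBrDl.
have um := halving_iter (ltW len0) KC0 step m.
set s := a + m%:R * len in um *.
have as_ : a <= s by rewrite lerDl mulr_ge0// ltW.
have st : s <= t by rewrite /s -lerBrDl.
have tsl : t <= s + len.
  by move: mgt; rewrite -natr1 mulrDl mul1r /s ltrBlDl addrA => /ltW.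
apply: le_trans (short s t as_ st tsl) _; rewrite lerD2r.
apply: (@le_trans _ _ (K * (u a / 2 ^+ m + 2 * (K * C)))).
  apply: (@le_trans _ _ (K * u s)); last by rewrite ler_wpM2l// ltW.
  by rewrite ler_wpM2r// expK// (le_trans a0).
rewrite mulrDr lerD2r mulrA ler_pdivrMr ?exprn_gt0// mul1r.
apply: (@le_trans _ _ (K * D)); first by rewrite ler_wpM2l// ltW.
apply: (@le_trans _ _ n%:R); first by rewrite ltW// truncnS_gt.
by rewrite -natrX ler_nat (leq_trans nm)// ltnW// ltn_expl.
Qed.

(** Brings a solution started at r < 0 up to time 0. As [r, 0] lies in [tau, 0], local integrability
    gives a bound independent of r. *)
Lemma gronwall_initial_bound (alpha beta : R -> R) (tau d : R) :
  locint alpha -> locint beta -> (forall t, 0 <= beta t) -> 0 <= d ->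
  exists2 D, 0 <= D & forall r u, tau <= r -> gronwall_on r alpha beta u ->
    (forall s, 0 <= u s) -> u r <= d -> u (Num.max r 0) <= D.
Proof.
move=> ialpha ibeta beta0 d0.
pose I := \int[mu]_(w in `[tau, 0]) `|alpha w|.
pose J := \int[mu]_(w in `[tau, 0]) beta w.
have I0 : 0 <= I by exact: Rintegral_ge0.
have J0 : 0 <= J by exact: Rintegral_ge0.
have dD : d <= expR I * d + expR I * J.
  apply: (@le_trans _ _ (expR I * d)); last by rewrite lerDl mulr_ge0// expR_ge0.
  by rewrite ler_peMl// -expR0 ler_expR.
exists (expR I * d + expR I * J); first exact: le_trans dD.
move=> r u taur gw u0 ur; have [r0|r0] := leP 0 r; first exact: le_trans ur dD.
have absI s : r <= s <= 0 -> expR (\int[mu]_(w in `[s, 0]) alpha w) <= expR I.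
  move=> /andP[rs s0]; rewrite ler_expR (le_trans (ler_norm _))//.
  apply: le_trans (le_normr_Rintegral _ (ialpha s 0)) _ => //.
  apply: ge0_le_Rintegral_itv => //; last exact: le_trans rs.
  exact: (integrable_norm (ialpha tau 0)).
apply: le_trans (gw r 0 (expR I) (lexx r) (ltW r0) absI) _; apply: lerD.
  by apply: ler_pM => //; apply: absI; rewrite lexx ltW.
rewrite ler_wpM2l ?expR_ge0//; apply: ge0_le_Rintegral_itv => //.
exact: ltW.
Qed.
End UltimateBound.

(** * Uniform ultimate boundedness of the solutions *)

Theorem theorem6p5 (R : realType) (N : nat) (f : R -> 'rV[R]_N -> 'rV[R]_N)
    (alpha beta : R -> R) :
  LC f -> H1 f alpha beta -> H3 beta -> H2star alpha ->
  forall tau : R, UUB f tau.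
Proof.
move=> lcf h1f h3 h2 tau; have [ialpha [ibeta [beta0 _]]] := h1f.
have [c c0 Hc] := gronwall_ultimate_bound ibeta beta0 h3 h2.
exists (Num.sqrt c); split; first by rewrite sqrtr_gt0.
move=> d d0.
have [D D0 HD] := @gronwall_initial_bound _ alpha beta tau (d ^+ 2)
  ialpha ibeta beta0 (sqr_ge0 d).
have [T T0 HT] := Hc D D0.
(* If r < 0, up to |tau| of the elapsed time passes before time 0, where the decay starts. *)
exists (T + `|tau|); split; first by rewrite ltr_wpDr.
move=> r t x0 x taur Tt x0d solx.
pose u s := dotv (x s) (x s).
have u0 s : 0 <= u s by exact: dotv_ge0.
have gw : gronwall_on r alpha beta u.
  by move=> a b L; exact: solution_gronwall solx.
have ur : u r <= d ^+ 2.
  rewrite /u solx.1 -enorm_sqr lerXn2r ?nnegrE ?sqrtr_ge0//.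
  exact: ltW.
have ua := HD r u taur gw u0 ur.
rewrite ler_sqrt ?(ltW c0)//.
apply: (HT r u (Num.max r 0)) => //; rewrite ?le_max ?lexx ?orbT//.
have taun : - `|tau| <= tau by rewrite lerNl -normrN ler_norm.
have := normr_ge0 tau.
by have [] := leP 0 r; lra.
Qed.
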